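(* Let $T$ be the oriented two-strand tangle diagram in which two oppositely oriented strands cross each other twice, once at a positive crossing $c_+$ and once at a negative crossing $c_-$ (the configuration on one side of a Reidemeister IIb move), let $T_0$ be the crossingless tangle with the same oriented endpoints obtained from $T$ by the Reidemeister IIb move (two disjoint, oppositely oriented arcs), and let $T_v$ be the diagram obtained from $T$ by replacing the positive crossing $c_+$ with a virtual crossing. Then $C(T)\not\simeq C(T_0)$; in fact $C(T)\simeq t\,q^{-2}\,C(T_v)$, as bicomplexes of modules over the edge ring.
   Context: Gradings and Koszul complexes: all rings are $\mathbb{Q}$-algebras; objects are graded by quantum degree (shift $q^k$), Hochschild degree (shift $a^j$) and homological degree (shift $t^k$: $t^kX$ places $X$ in homological degree $k$). For a polynomial ring $R$ with variables of quantum degree $2$ and homogeneous $p$ of quantum degree $k$, $[p]_R = (q^kaR\xrightarrow{p}R)$, and for $p_1,\dots,p_m$ the Koszul complex is $[p_1]_R\otimes_R\cdots\otimes_R[p_m]_R$. Local complexes (diagrams cut by marks into pieces, each mark carrying a variable; gluing along shared variables $z$ = tensor product over $\mathbb{Q}[z]$, disjoint union = tensor over $\mathbb{Q}$): an arc $x\to y$ gets $[y-x]$; a MOY vertex (4-valent vertex, incoming $x_1,x_2$ at bottom-left/right, outgoing $y_1,y_2$ at top-left/right) gets the Koszul complex over $E=\mathbb{Q}[x_1,x_2,y_1,y_2]$ of $y_1+y_2-x_1-x_2,(y_1-x_1)(y_1-x_2)$, written explicitly as $a^2q^6E\to aq^2E\oplus aq^4E\to E$ with maps $((y_1-x_1)(y_1-x_2),\,y_1+y_2-x_1-x_2)^T$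 and $(x_1+x_2-y_1-y_2,\ (y_1-x_1)(y_1-x_2))$; a virtual crossing (transverse double point with no crossing information, strand $x_1\to y_2$, $x_2\to y_1$) gets the Koszul complex of $y_1-x_2,y_2-x_1$. The oriented smoothing (arcs $x_1\to y_1$, $x_2\to y_2$) has complex $a^2q^4E\to aq^2E\oplus aq^2E\to E$ with maps $(y_1-x_1,y_2-x_2)^T$ and $(x_2-y_2,\ y_1-x_1)$. Chain maps $\chi_i:C(\text{smoothing})\to q^{-2}C(\text{vertex})$ and $\chi_o:C(\text{vertex})\to C(\text{smoothing})$ are given (Hochschild degrees $2,1,0$) by $\chi_i=(1,\ \begin{psmallmatrix}y_1-x_2&0\\1&1\end{psmallmatrix},\ y_1-x_2)$ and $\chi_o=(y_1-x_2,\ \begin{psmallmatrix}1&0\\-1&y_1-x_2\end{psmallmatrix},\ 1)$. For a crossing with both strands oriented upward (positive when the over-strand runs from bottom-left to top-right), $C(\text{positive})=\big(C(\text{smoothing})\xrightarrow{\chi_i}tq^{-2}C(\text{vertex})\big)$ and $C(\text{negative})=\big(t^{-1}C(\text{vertex})\xrightarrow{\chi_o}C(\text{smoothing})\big)$; a crossing in arbitrary position is assigned the complex after rotating it so both strands point upward. The complex $C(D)$ of a (virtual) tangle diagram $D$ is a bicomplex (Koszul differential and crossing differential) of modules over the edge ring, the polynomial ring in the variables at the boundary endpoints; $\simeq$ denotes homotopy equivalence of such bicomplexes. *)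

(* Defs.v *)
From HB Require Import structures.
From mathcomp Require Import all_boot all_algebra.
From mathcomp Require Import mpoly.
Set Implicit Arguments. Unset Strict Implicit. Unset Printing Implicit Defensive.
Import GRing.Theory.
Local Open Scope ring_scope.

(* Tri-graded bicomplexes of finitely generated free modules over the  *)
(* polynomial ring Q[X_0, ..., X_(n-1)] (all variables in q-degree 2).  *)
(* A generator g carries a quantum shift qsh g (it sits in q-degree     *)
(* qsh g), a Hochschild degree hdeg g and a homological degree tdeg g.  *)
(* Differentials are given by their matrices: dK g l (resp. dT g l) is  *)
(* the coefficient of generator l in d_K(g) (resp. d_T(g)).  d_K is the *)
(* Koszul differential (lowers hdeg by 1), d_T the crossing differential*)
(* (raises tdeg by 1); both preserve q-degree and they commute.         *)
Record bicx (n : nat) := Bicx {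
  gen : finType;
  qsh : gen -> int;
  hdeg : gen -> int;
  tdeg : gen -> int;
  dK : gen -> gen -> {mpoly rat[n]};
  dT : gen -> gen -> {mpoly rat[n]} }.
Arguments gen {n} b.
Arguments qsh {n} b _.
Arguments hdeg {n} b _.
Arguments tdeg {n} b _.
Arguments dK {n} b _ _.
Arguments dT {n} b _ _.

Definition elt n (C : bicx n) := {ffun gen C -> {mpoly rat[n]}}.

Definition app n (C : bicx n) (M : gen C -> gen C -> {mpoly rat[n]})
  (v : elt C) : elt C := [ffun l => \sum_i v i * M i l].

Definition smul n (C : bicx n) (p : {mpoly rat[n]}) (v : elt C) : elt C :=
  [ffun i => p * v i].

Definition homog_at n (C : bicx n) (d j k : int) (v : elt C) : Prop :=
  forall i, v i != 0 ->
    [/\ hdeg C i = j, tdeg C i = k &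
        exists m : nat, (2 * m)%:Z + qsh C i = d /\ v i \is m.-homog].

(* The edge ring is Q[X_0,..,X_3]; complexes are over Q[X_0,..,X_(3+m)],  *)
(* the extra m variables being internal marks.                            *)
Definition evar m (i : 'I_4) : {mpoly rat[4 + m]} := 'X_(lshift m i).

Definition elinear m1 m2 (C : bicx (4 + m1)) (D : bicx (4 + m2))
  (f : elt C -> elt D) : Prop :=
  [/\ forall u v, f (u + v) = f u + f v,
      forall (c : rat) v, f (smul c%:MP v) = smul c%:MP (f v) &
      forall (i : 'I_4) v, f (smul (evar m1 i) v) = smul (evar m2 i) (f v)].

Definition shifts_by n1 n2 (C : bicx n1) (D : bicx n2) (dj dk : int)
  (f : elt C -> elt D) : Prop :=
  forall d j k v, homog_at d j k v -> homog_at d (j + dj) (k + dk) (f v).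

Definition bimap m1 m2 (C : bicx (4 + m1)) (D : bicx (4 + m2))
  (f : elt C -> elt D) : Prop :=
  [/\ elinear f, shifts_by 0 0 f,
      forall v, f (app (dK C) v) = app (dK D) (f v) &
      forall v, f (app (dT C) v) = app (dT D) (f v)].

(* homotopy between two morphisms: f - g = [d_K, hK] + [d_T, hT], with hK  *)
(* commuting with d_T and hT commuting with d_K (equivalently, a homotopy  *)
(* hK + (-1)^hdeg hT of the total complex d_K + (-1)^hdeg d_T).           *)
Definition htpy m1 m2 (C : bicx (4 + m1)) (D : bicx (4 + m2))
  (f g : elt C -> elt D) : Prop :=
  exists hK hT : elt C -> elt D,
  [/\ elinear hK /\ elinear hT, shifts_by 1 0 hK /\ shifts_by 0 (-1) hT,
      forall v, f v - g v = app (dK D) (hK v) + hK (app (dK C) v)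
                          + app (dT D) (hT v) + hT (app (dT C) v),
      forall v, app (dK D) (hT v) = hT (app (dK C) v) &
      forall v, app (dT D) (hK v) = hK (app (dT C) v)].

Definition heq m1 m2 (C : bicx (4 + m1)) (D : bicx (4 + m2)) : Prop :=
  exists (f : elt C -> elt D) (g : elt D -> elt C),
  [/\ bimap f, bimap g, htpy (g \o f) id & htpy (f \o g) id].

Definition sgn n (j : int) : {mpoly rat[n]} := if odd `|j|%N then -1 else 1.

Definition btens n (C D : bicx n) : bicx n :=
  @Bicx n (gen C * gen D)%type
    (fun g => qsh C g.1 + qsh D g.2)
    (fun g => hdeg C g.1 + hdeg D g.2)
    (fun g => tdeg C g.1 + tdeg D g.2)
    (fun g l => (if g.2 == l.2 then dK C g.1 l.1 else 0)
              + (if g.1 == l.1 then sgn n (hdeg C g.1) * dK D g.2 l.2 else 0))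
    (fun g l => (if g.2 == l.2 then dT C g.1 l.1 else 0)
              + (if g.1 == l.1 then sgn n (tdeg C g.1) * dT D g.2 l.2 else 0)).

Definition bshift n (C : bicx n) (a b : int) : bicx n :=
  @Bicx n (gen C) (fun g => qsh C g + b) (hdeg C) (fun g => tdeg C g + a)
    (dK C) (dT C).

(* [p] = (q^k a R --p--> R); generator true is the one in Hochschild degree 1 *)
Definition kos1 n (p : {mpoly rat[n]}) (k : int) : bicx n :=
  @Bicx n bool (fun g => if g then k else 0) (fun g => if g then 1 else 0)
    (fun _ => 0) (fun g l => if g && ~~ l then p else 0) (fun _ _ => 0).

Definition arc n (x y : {mpoly rat[n]}) : bicx n := kos1 (y - x) 2.

Definition virt n (x1 x2 y1 y2 : {mpoly rat[n]}) : bicx n :=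
  btens (kos1 (y1 - x2) 2) (kos1 (y2 - x1) 2).

Section Crossings.
Variables (n : nat) (x1 x2 y1 y2 : {mpoly rat[n]}).

(* Koszul generators, indexed by 'I_4: 0 = a^2 summand, 1 and 2 = the two  *)
(* a^1 summands (in the order written), 3 = a^0 summand.                  *)
Definition kh (i : 'I_4) : int :=
  if val i == 0%N then 2 else if val i == 3%N then 0 else 1.

(* MOY vertex: a^2q^6E -> aq^2E + aq^4E -> E *)
Definition vq (i : 'I_4) : int :=
  match val i with 0%N => 6 | 1%N => 2 | 2%N => 4 | _ => 0 end.
Definition vd (i l : 'I_4) : {mpoly rat[n]} :=
  match val i, val l with
  | 0%N, 1%N => (y1 - x1) * (y1 - x2)
  | 0%N, 2%N => y1 + y2 - x1 - x2
  | 1%N, 3%N => x1 + x2 - y1 - y2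
  | 2%N, 3%N => (y1 - x1) * (y1 - x2)
  | _, _ => 0 end.

(* oriented smoothing: a^2q^4E -> aq^2E + aq^2E -> E *)
Definition sq (i : 'I_4) : int :=
  match val i with 0%N => 4 | 1%N => 2 | 2%N => 2 | _ => 0 end.
Definition sd (i l : 'I_4) : {mpoly rat[n]} :=
  match val i, val l with
  | 0%N, 1%N => y1 - x1
  | 0%N, 2%N => y2 - x2
  | 1%N, 3%N => x2 - y2
  | 2%N, 3%N => y1 - x1
  | _, _ => 0 end.

(* chi_i : C(smoothing) -> q^-2 C(vertex); coefficient of vertex generator l *)
(* in the image of smoothing generator i.                                  *)
Definition chi_in (i l : 'I_4) : {mpoly rat[n]} :=
  match val i, val l with
  | 0%N, 0%N => 1
  | 1%N, 1%N => y1 - x2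
  | 1%N, 2%N => 1
  | 2%N, 2%N => 1
  | 3%N, 3%N => y1 - x2
  | _, _ => 0 end.

(* chi_o : C(vertex) -> C(smoothing) *)
Definition chi_out (i l : 'I_4) : {mpoly rat[n]} :=
  match val i, val l with
  | 0%N, 0%N => y1 - x2
  | 1%N, 1%N => 1
  | 1%N, 2%N => -1
  | 2%N, 2%N => y1 - x2
  | 3%N, 3%N => 1
  | _, _ => 0 end.

(* C(positive) = (C(smoothing) --chi_i--> t q^-2 C(vertex)):             *)
(* inl = smoothing generators (t-degree 0), inr = vertex generators.     *)
Definition poscx : bicx n :=
  @Bicx n ('I_4 + 'I_4)%type
    (fun g => match g with inl i => sq i | inr i => vq i - 2 end)
    (fun g => match g with inl i => kh i | inr i => kh i end)
    (fun g => match g with inl _ => 0 | inr _ => 1 end)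
    (fun g l => match g, l with
                | inl i, inl j => sd i j
                | inr i, inr j => vd i j
                | _, _ => 0 end)
    (fun g l => match g, l with
                | inl i, inr j => chi_in i j
                | _, _ => 0 end).

(* C(negative) = (t^-1 C(vertex) --chi_o--> C(smoothing)):               *)
(* inl = vertex generators (t-degree -1), inr = smoothing generators.    *)
Definition negcx : bicx n :=
  @Bicx n ('I_4 + 'I_4)%type
    (fun g => match g with inl i => vq i | inr i => sq i end)
    (fun g => match g with inl i => kh i | inr i => kh i end)
    (fun g => match g with inl _ => -1 | inr _ => 0 end)
    (fun g l => match g, l with
                | inl i, inl j => vd i j
                | inr i, inr j => sd i j
                | _, _ => 0 end)
    (fun g l => match g, l with
                | inl i, inr j => chi_out i j
                | _, _ => 0 end).
End Crossings.

(* The tangles.  Strand A runs upward from a0 (bottom-left) through the  *)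
(* internal mark a1 to a2 (top-left); strand B runs downward from b0      *)
(* (top-right) through the internal mark b1 to b2 (bottom-right).  A is   *)
(* the over-strand at both crossings.  Upper crossing c+ (positive): over *)
(* strand a1 -> a2, under strand b0 -> b1; rotated upright: x1 = a1,      *)
(* y2 = a2, x2 = b0, y1 = b1.  Lower crossing c- (negative): over strand   *)
(* a0 -> a1, under strand b1 -> b2; rotated upright: x2 = a0, y1 = a1,    *)
(* x1 = b1, y2 = b2.                                                      *)
(* Edge ring Q[a0,a2,b0,b2] = Q[X_0..X_3]; over Q[X_0..X_5], a1 = X_4,    *)
(* b1 = X_5.                                                              *)
Definition va0 m : {mpoly rat[4 + m]} := evar m (@Ordinal 4 0 isT).
Definition va2 m : {mpoly rat[4 + m]} := evar m (@Ordinal 4 1 isT).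
Definition vb0 m : {mpoly rat[4 + m]} := evar m (@Ordinal 4 2 isT).
Definition vb2 m : {mpoly rat[4 + m]} := evar m (@Ordinal 4 3 isT).
Definition va1 : {mpoly rat[4 + 2]} := 'X_(rshift 4 (@Ordinal 2 0 isT)).
Definition vb1 : {mpoly rat[4 + 2]} := 'X_(rshift 4 (@Ordinal 2 1 isT)).

(* C(c+), C(c-), C(T) = C(c+) (x)_{Q[a1,b1]} C(c-) *)
Definition Cplus : bicx (4 + 2) := poscx va1 (vb0 2) vb1 (va2 2).
Definition Cminus : bicx (4 + 2) := negcx vb1 (va0 2) va1 (vb2 2).
Definition CT : bicx (4 + 2) := btens Cplus Cminus.

Definition CTv : bicx (4 + 2) := btens (virt va1 (vb0 2) vb1 (va2 2)) Cminus.

Definition CT0 : bicx (4 + 0) := btens (arc (va0 0) (va2 0)) (arc (vb0 0) (vb2 0)).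

(* Main.v *)
Require Import Defs.
From HB Require Import structures.
From mathcomp Require Import all_boot all_algebra.
From mathcomp Require Import mpoly.
From Stdlib Require BinList ZArith Ring_polynom InitialRing.
Local Open Scope ring_scope.
Set Implicit Arguments. Unset Strict Implicit. Unset Printing Implicit Defensive.
Import GRing.Theory.

(** Put y = b1 - b0.  On the Koszul side C(c+) is [b1 + a2 - a1 - b0] tensored
    with [b1 - a1] -> [(b1 - a1) y], the map being y in Hochschild degree 0 and
    1 in degree 1.  In the crossing direction this retracts onto its vertex part
    modulo y; dividing by y is not linear over Q[a1, b1], but it is linear over
    the edge ring, and it commutes with d_K once a1 - b1 (rather than a1) is kept
    fixed, because c- then sees y only through the coefficient a1 - a0 of chi_o.
    Correcting the retraction on that coefficient deforms C(T), by a homotopy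
    in the crossing direction only, onto a complex in which b1 = b0; the Koszul
    factor [b1 - b0] of the virtual crossing deforms C(T_v) onto the same complex
    by a homotopy in the Koszul direction only.  All maps are semilinear over
    substitutions of a1, b1 that fix the edge variables.

    For the inequivalence, let z be the generator of vertex (x) smoothing in
    homological degree 1, Hochschild degree 1 and quantum degree 0.  Every map to
    C(T_0) kills z, since C(T_0) lives in homological degree 0, so a homotopy
    would give z = [d_K, hK] z + [d_T, hT] z.  For degree reasons this makes z a
    d_T-boundary, which it is not, even after setting all variables to 0. *)

(** * Dividing p - p(t) by a common divisor of the X_i - t_i *)

Section Substitution.
Variables (n : nat) (t : n.-tuple {mpoly rat[n]}) (y : {mpoly rat[n]}).
Hypothesis t_hom : forall i, tnth t i \is 1.-homog.
Local Notation R := {mpoly rat[n]}.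

Lemma comp_mpoly_homog d (p : R) : p \is d.-homog -> p \mPo t \is d.-homog.
Proof.
move=> /dhomogP ph; rewrite comp_mpolyEX big_seq; apply: rpred_sum => m mp.
have <- : mdeg m = d by exact: ph.
apply: rpredZ; rewrite comp_mpolyX mdegE.
apply: (big_ind2 (fun p e => p \is e.-homog)) => [|p1 d1 p2 d2 h1 h2|i _].
- exact: dhomog1.
- exact: dhomogM.
by rewrite -[X in X.-homog]mul1n; apply: dhomogMn.
Qed.

Hypothesis y_neq0 : y != 0.
Hypothesis t_div : forall i, exists c : rat, 'X_i - tnth t i = y * c%:MP.

Lemma subst_div_monomial (m : 'X_{1..n}) : exists q : R,
  [/\ 'X_[m] - ('X_[m] \mPo t) = y * q, q \is (mdeg m).-1.-homog
    & mdeg m = 0%N -> q = 0].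
Proof.
have [k] := ubnP (mdeg m); elim: k m => // k IHk m; rewrite ltnS => mk.
have [m0|[i mi]] : m = 0%MM \/ exists i, m i != 0%N.
- have [/forallP h|] := boolP [forall i, m i == 0%N].
    by left; apply/mnmP=> i; rewrite mnm0E; apply/eqP.
  by rewrite negb_forall => /existsP h; right.
- exists 0; split; rewrite ?rpred0 //.
  by rewrite m0 mpolyX0 comp_mpoly1 subrr mulr0.
pose m' := (m - U_(i))%MM.
have mE : m = (U_(i) + m')%MM.
  by rewrite addmC submK // lep1mP.
have dE : mdeg m = (mdeg m').+1 by rewrite mE mdegD mdeg1.
have [|q [qE qh q0]] := IHk m'; first by rewrite -ltnS -dE.
(* Telescoping with m = X_i m': X_i m' - t_i m'(t) = (X_i - t_i) m' + t_i (m' - m'(t)). *)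
have [c cE] := t_div i; exists (c%:MP * 'X_[m'] + tnth t i * q); split.
- rewrite mE mpolyXD rmorphM /= -/('X_i) comp_mpolyXU -tnth_nth.
  rewrite [RHS]mulrDr (mulrA y c%:MP) -cE (mulrCA y) -qE mulrBl mulrBr.
  by rewrite addrA subrK.
- rewrite dE /=; apply: rpredD.
    by rewrite mul_mpolyC; apply: rpredZ; rewrite dhomogX.
  (* In degree 0 the predecessor is truncated, so the clause q = 0 has to be used instead of the
     degree count. *)
  have [d0|dn] := eqVneq (mdeg m') 0%N; first by rewrite q0 // mulr0 rpred0.
  by rewrite -[mdeg m']prednK ?lt0n // -add1n; apply: dhomogM.
- by rewrite dE.
Qed.

(** The boolean equality makes the existence usable by [xchoose]. *)
Lemma subst_div_ex (p : R) : exists q, p - (p \mPo t) == y * q.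
Proof.
elim/mpolyind: p => [|c m p _ _ [q /eqP qE]].
  by exists 0; rewrite comp_mpoly0 subrr mulr0.
have [r [rE _ _]] := subst_div_monomial m; exists (c *: r + q).
by rewrite comp_mpolyD comp_mpolyZ opprD addrACA qE -scalerBr rE mulrDr -scalerAr.
Qed.

(** A divided difference operator; since y is not a zero divisor, the choice is the only possible
    one. *)
Definition subst_div p := xchoose (subst_div_ex p).

Lemma subst_divE p : y * subst_div p = p - (p \mPo t).
Proof. exact/esym/eqP/(xchooseP (subst_div_ex p)). Qed.

Lemma subst_div_uniq p q : y * q = p - (p \mPo t) -> subst_div p = q.
Proof. by rewrite -subst_divE => /(mulfI y_neq0). Qed.

Lemma subst_divD : {morph subst_div : p q / p + q}.
Proof.
move=> p q; apply: subst_div_uniq.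
by rewrite mulrDr !subst_divE comp_mpolyD opprD addrACA.
Qed.

(** Applied to the edge variables, which both substitutions fix, this makes the divided homotopies
    linear over the edge ring. *)
Lemma subst_divMl c p : c \mPo t = c -> subst_div (c * p) = c * subst_div p.
Proof.
move=> cE; apply: subst_div_uniq.
by rewrite mulrCA subst_divE rmorphM /= cE mulrBr.
Qed.

Lemma subst_div_homog d p :
  p \is d.-homog -> subst_div p != 0 -> exists d', d = d'.+1 /\ subst_div p \is d'.-homog.
Proof.
move=> /dhomogP ph nz.
have [q [qE qh q0]] : exists q, [/\ y * q = p - (p \mPo t), q \is d.-1.-homog
    & d = 0%N -> q = 0].
  (* Generalising the support of p to any list of monomials of degree d allows induction within a
     fixed degree. *)
  suff main (a : 'X_{1..n} -> rat) (s : seq 'X_{1..n}) :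
      {in s, forall m, mdeg m = d} -> exists q, [/\ y * q =
      \sum_(m <- s) a m *: 'X_[m] - (\sum_(m <- s) a m *: 'X_[m] \mPo t),
      q \is d.-1.-homog & d = 0%N -> q = 0].
    by have := main (fun m => p@_m) (msupp p) ph; rewrite -mpolyE.
  elim: s => [|m s IHs] sd.
    by exists 0; split; rewrite ?rpred0 // big_nil comp_mpoly0 subrr mulr0.
  have dm : mdeg m = d by apply: sd; exact: mem_head.
  have [r [rE rh r0]] := subst_div_monomial m.
  have [m' m's|q [qE qh q0]] := IHs; first by apply: sd; rewrite inE m's orbT.
  exists (a m *: r + q); split; last first.
  - by move=> d0; rewrite r0 ?dm // q0 // scaler0 addr0.
  - by rewrite -dm in qh *; apply: rpredD => //; apply: rpredZ.
  by rewrite big_cons comp_mpolyD comp_mpolyZ opprD addrACA -scalerBr rE mulrDr qE scalerAr.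
move: nz; rewrite (subst_div_uniq qE) => nz; case: d ph qh q0 {qE} => [|d] _ qh q0.
  by rewrite q0 ?eqxx in nz.
by exists d.
Qed.

End Substitution.

(** * Semilinear maps given by matrices, and their degrees *)

Section Semilinear.
Variable n : nat.
Local Notation R := {mpoly rat[n]}.

(** [phi] is a bare function because the divided difference, which is not multiplicative, is among
    its values. *)
Definition slin (C D : bicx n) (phi : R -> R) (M : gen C -> gen D -> R)
  (v : elt C) : elt D := [ffun l => \sum_i phi (v i) * M i l].

Lemma eq_slin (C D : bicx n) phi (M N : gen C -> gen D -> R) v :
  (forall i l, M i l = N i l) -> slin phi M v = slin phi N v.
Proof.
by move=> h; apply/ffunP=> l; rewrite !ffunE; apply: eq_bigr => i _; rewrite h.
Qed.

Lemma slin_app (C : bicx n) (M : gen C -> gen C -> R) v : app M v = slin idfun M v.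
Proof. by []. Qed.

Lemma slin_comp (C D E : bicx n) phi (psi : {rmorphism R -> R})
    (M : gen C -> gen D -> R) (N : gen D -> gen E -> R) v :
  slin psi N (slin phi M v)
  = slin (fun p => psi (phi p)) (fun i l => \sum_j psi (M i j) * N j l) v.
Proof.
apply/ffunP=> l; rewrite !ffunE.
under eq_bigr => j _ do rewrite ffunE rmorph_sum mulr_suml.
rewrite exchange_big; apply: eq_bigr => i _; rewrite mulr_sumr.
by apply: eq_bigr => j _; rewrite rmorphM mulrA.
Qed.

Lemma slinD (C D : bicx n) phi (M N : gen C -> gen D -> R) v :
  slin phi M v + slin phi N v = slin phi (fun i l => M i l + N i l) v.
Proof.
apply/ffunP=> l; rewrite !ffunE -big_split; apply: eq_bigr => i _ /=.
by rewrite mulrDr.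
Qed.

Lemma shifts_by_add (C D : bicx n) dj dk (f g : elt C -> elt D) :
  shifts_by dj dk f -> shifts_by dj dk g -> shifts_by dj dk (fun v => f v + g v).
Proof.
move=> hf hg d j k v hv i; rewrite ffunE => nz.
have F := hf _ _ _ _ hv i; have G := hg _ _ _ _ hv i.
have [f0|fn] := eqVneq (f v i) 0.
  by move: nz; rewrite f0 add0r => /G.
have [g0|gn] := eqVneq (g v i) 0.
  by move: nz; rewrite g0 addr0 => /F.
have [-> -> [a [ea ha]]] := F fn; have [_ _ [b [eb hb]]] := G gn.
split=> //; exists a; split=> //; apply: rpredD => //.
suff -> : a = b by [].
(* All variables have quantum degree 2, so the quantum degree determines the polynomial degree. *)
by move: ea; rewrite -eb => /addIr [] /eqP; rewrite eqn_pmul2l // => /eqP.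
Qed.

Definition lowers_deg (e : nat) (phi : R -> R) := forall d p,
  p \is d.-homog -> phi p != 0 -> exists d', d = (d' + e)%N /\ (phi p \is d'.-homog).

(** The matrix entries raise the quantum degree by the 2e that [phi] takes away, so the map
    preserves it. *)
Lemma slin_shifts (C D : bicx n) dj dk e phi (M : gen C -> gen D -> R) :
  phi 0 = 0 -> lowers_deg e phi ->
  (forall i l, M i l != 0 -> [/\ hdeg D l = hdeg C i + dj, tdeg D l = tdeg C i + dk &
     exists d, (2 * d)%:Z + qsh D l = qsh C i + (2 * e)%:Z /\ M i l \is d.-homog]) ->
  shifts_by dj dk (slin phi M).
Proof.
move=> phi0 hphi hM d j k v hv l; rewrite ffunE => nz.
have term i : phi (v i) * M i l != 0 -> [/\ hdeg D l = j + dj, tdeg D l = k + dk &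
    exists r, (2 * r)%:Z + qsh D l = d /\ phi (v i) * M i l \is r.-homog].
  rewrite mulf_eq0 negb_or => /andP[nzv /[dup] nzM /hM [eh et [b [eb hb]]]].
  have [|ej ek [r [er hr]]] := hv i.
    by apply: contraNneq nzv => ->; rewrite phi0.
  have [r' [eqr hr']] := hphi _ _ hr nzv.
  rewrite eh et ej ek; split=> //; exists (r' + b)%N; split; last exact: dhomogM.
  by rewrite mulnDr PoszD -addrA eb addrA addrAC -er eqr mulnDr PoszD.
have [/forallP h|] := boolP [forall i, phi (v i) * M i l == 0].
  by case/eqP: nz; apply: big1 => i _; apply/eqP/h.
rewrite negb_forall => /existsP[i0 /term [-> -> [r [er _]]]]; split=> //.
exists r; split=> //; apply: rpred_sum => i _.
have [->|/term [_ _ [b [eb hb]]]] := eqVneq (phi (v i) * M i l) 0; first exact: rpred0.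
suff -> : r = b by [].
by move: er; rewrite -eb => /addIr [] /eqP; rewrite eqn_pmul2l // => /eqP.
Qed.

End Semilinear.

Lemma slin_elinear m (C D : bicx (4 + m)) phi (M : gen C -> gen D -> {mpoly rat[4 + m]}) :
  {morph phi : p q / p + q} -> (forall (c : rat) p, phi (c%:MP * p) = c%:MP * phi p) ->
  (forall i p, phi (evar m i * p) = evar m i * phi p) -> elinear (slin phi M).
Proof.
move=> phiD phiC phiX; split=> [u v|c v|i v]; apply/ffunP=> l; rewrite !ffunE.
- by rewrite -big_split; apply: eq_bigr => i _; rewrite ffunE phiD mulrDl.
- by rewrite mulr_sumr; apply: eq_bigr => i _; rewrite ffunE phiC mulrA.
- by rewrite mulr_sumr; apply: eq_bigr => j _; rewrite ffunE phiX mulrA.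
Qed.

Lemma elinear_add m (C D : bicx (4 + m)) (f g : elt C -> elt D) :
  elinear f -> elinear g -> elinear (fun v => f v + g v).
Proof.
move=> [f1 f2 f3] [g1 g2 g3]; split=> [u v|c v|i v].
- by rewrite f1 g1 addrACA.
- by rewrite f2 g2; apply/ffunP=> l; rewrite !ffunE mulrDr.
- by rewrite f3 g3; apply/ffunP=> l; rewrite !ffunE mulrDr.
Qed.

(** * Homotopies obtained by dividing by y *)

Section DividedHomotopy.
Variables (n : nat) (t : n.-tuple {mpoly rat[n]}) (y : {mpoly rat[n]}).
Local Notation R := {mpoly rat[n]}.
Hypothesis t_hom : forall i, tnth t i \is 1.-homog.
Hypothesis y_neq0 : y != 0.
Hypothesis t_div : forall i, exists c : rat, 'X_i - tnth t i = y * c%:MP.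
Let theta : {rmorphism R -> R} := comp_mpoly t.
Let delta := subst_div t_hom t_div.
Variables (C : bicx n) (A B : gen C -> gen C -> R).

(* The operator (A + theta (y B - A)) / y, so that identities about it reduce to
   identities between the semilinear operators A and theta (y B - A). *)
Definition div_htpy (v : elt C) : elt C := slin delta A v + slin theta B v.

Let A' i l := y * B i l - A i l.

Lemma smul_div_htpy v : smul y (div_htpy v) = slin idfun A v + slin theta A' v.
Proof.
apply/ffunP=> l; rewrite !ffunE mulrDr !mulr_sumr -!big_split /=; apply: eq_bigr => i _.
rewrite mulrA subst_divE // /A' mulrBl [in RHS]mulrBr (mulrCA y) -addrA.
by rewrite [- _ + _]addrC.
Qed.

Lemma smulI : injective (@smul n C y).
Proof.
move=> u v /ffunP h; apply/ffunP=> l; move: (h l); rewrite !ffunE; exact: mulfI.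
Qed.

Lemma app_smul (M : gen C -> gen C -> R) v : app M (smul y v) = smul y (app M v).
Proof.
by apply/ffunP=> l; rewrite !ffunE mulr_sumr; apply: eq_bigr => i _; rewrite ffunE mulrA.
Qed.

Lemma appD (M : gen C -> gen C -> R) u v : app M (u + v) = app M u + app M v.
Proof.
by apply/ffunP=> l; rewrite !ffunE -big_split; apply: eq_bigr => i _; rewrite ffunE mulrDl.
Qed.

(** Multiplication by y is injective and commutes with [app M], so linear and [theta]-semilinear
    parts can be compared separately; moving [M] through the latter replaces it by [theta] of
    [M]. *)
Lemma div_htpy_comm (M : gen C -> gen C -> R) :
  (forall i l, \sum_j A i j * M j l = \sum_j M i j * A j l) ->
  (forall i l, \sum_j A' i j * M j l = \sum_j theta (M i j) * A' j l) ->
  forall v, app M (div_htpy v) = div_htpy (app M v).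
Proof.
move=> h h' v; apply: smulI; rewrite smul_div_htpy -app_smul smul_div_htpy appD !slin_app.
by rewrite !slin_comp /=; congr (_ + _); apply: eq_slin => i l; rewrite /= ?h ?h'.
Qed.

(** If [A] is a null-homotopy of -y, its linear part divided by y yields minus the identity, and the
    [theta] part yields [Phi]: a homotopy from the identity to a map that factors through the
    substitution. *)
Lemma div_htpy_anticomm (M Phi : gen C -> gen C -> R) :
  (forall i l, \sum_j A i j * M j l + \sum_j M i j * A j l = if i == l then - y else 0) ->
  (forall i l, \sum_j A' i j * M j l + \sum_j theta (M i j) * A' j l = y * Phi i l) ->
  forall v, app M (div_htpy v) + div_htpy (app M v) = slin theta Phi v - v.
Proof.
move=> h h' v; apply: smulI.
have smulD (u w : elt C) : smul y (u + w) = smul y u + smul y w.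
  by apply/ffunP=> l; rewrite !ffunE mulrDr.
have -> : smul y (app M (div_htpy v) + div_htpy (app M v))
  = slin idfun (fun i l => \sum_j A i j * M j l + \sum_j M i j * A j l) v
  + slin theta (fun i l => \sum_j A' i j * M j l + \sum_j theta (M i j) * A' j l) v.
  have e1 : smul y (app M (div_htpy v)) = slin idfun (fun i l => \sum_j A i j * M j l) v
      + slin theta (fun i l => \sum_j A' i j * M j l) v.
    by rewrite -app_smul smul_div_htpy appD !slin_app !slin_comp.
  have e2 : smul y (div_htpy (app M v)) = slin idfun (fun i l => \sum_j M i j * A j l) v
      + slin theta (fun i l => \sum_j theta (M i j) * A' j l) v.
    by rewrite smul_div_htpy slin_app !slin_comp.
  by rewrite smulD e1 e2 addrACA !slinD.
apply/ffunP=> l; rewrite !ffunE; under eq_bigr => i _ do rewrite h.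
rewrite [in X in _ + X](eq_bigr _ (fun i _ => congr1 _ (h' i l))).
rewrite (bigD1 l) //= eqxx big1 ?addr0 => [|i /negPf ->]; last by rewrite mulr0.
rewrite addrC mulrDr mulrN mulr_sumr; congr (_ + _); last by rewrite /= mulrN mulrC.
by apply: eq_bigr => i _; rewrite mulrCA.
Qed.

(** The divided difference lowers quantum degree by 2, which [A] must restore; [theta] preserves it,
    so [B] has quantum degree 0. *)
Lemma div_htpy_shifts dj dk :
  (forall i l, A i l != 0 -> [/\ hdeg C l = hdeg C i + dj, tdeg C l = tdeg C i + dk &
     exists d, (2 * d)%:Z + qsh C l = qsh C i + 2 /\ A i l \is d.-homog]) ->
  (forall i l, B i l != 0 -> [/\ hdeg C l = hdeg C i + dj, tdeg C l = tdeg C i + dk &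
     exists d, (2 * d)%:Z + qsh C l = qsh C i /\ B i l \is d.-homog]) ->
  shifts_by dj dk div_htpy.
Proof.
move=> hA hB; apply: shifts_by_add.
  apply: (@slin_shifts _ _ _ _ _ 1%N) => // [|d p hp nz].
    by apply: subst_div_uniq => //; rewrite mulr0 rmorph0 subrr.
  by have [d' [-> ?]] := subst_div_homog y_neq0 hp nz; exists d'; rewrite addn1.
apply: (@slin_shifts _ _ _ _ _ 0%N) => [|d p hp nz|i l /hB [-> -> [d [eqd hd]]]].
- exact: rmorph0.
- by exists d; rewrite addn0; split=> //; apply: comp_mpoly_homog.
- by split=> //; exists d; rewrite eqd addr0.
Qed.

End DividedHomotopy.

(** * Sparse matrices of formal polynomials *)

Inductive pexp :=
  PVar of nat | PZero | POne | PAdd of pexp & pexp | PMul of pexp & pexp | POpp of pexp.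

Declare Scope pexp_scope.
Delimit Scope pexp_scope with P.
Bind Scope pexp_scope with pexp.
Notation "0" := PZero : pexp_scope.
Notation "1" := POne : pexp_scope.
Notation "p + q" := (PAdd p q) : pexp_scope.
Notation "p * q" := (PMul p q) : pexp_scope.
Notation "- p" := (POpp p) : pexp_scope.
Notation "p - q" := (PAdd p (POpp q)) : pexp_scope.

Fixpoint to_pexpr (p : pexp) : Ring_polynom.PExpr BinNums.Z :=
  match p with
  | PVar i => Ring_polynom.PEX _ (BinPos.Pos.of_succ_nat i)
  | PZero => Ring_polynom.PEO
  | POne => Ring_polynom.PEI
  | PAdd p q => Ring_polynom.PEadd (to_pexpr p) (to_pexpr q)
  | PMul p q => Ring_polynom.PEmul (to_pexpr p) (to_pexpr q)
  | POpp p => Ring_polynom.PEopp (to_pexpr p)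
  end.

(** The normal form behind the [ring] tactic, with integer coefficients and no side equations; it
    lets [vm_compute] decide matrix identities. *)
Definition pnorm (p : pexp) : Ring_polynom.Pol BinNums.Z :=
  Ring_polynom.norm_subst BinNums.Z0 (BinNums.Zpos BinNums.xH)
    BinInt.Z.add BinInt.Z.mul BinInt.Z.sub BinInt.Z.opp
    BinInt.Z.eqb BinInt.Z.quotrem 0 nil (to_pexpr p).

Definition peqb (p q : pexp) := Ring_polynom.Peq BinInt.Z.eqb (pnorm p) (pnorm q).

Fixpoint psubst (s : nat -> pexp) (p : pexp) : pexp :=
  match p with
  | PVar i => s i
  | PAdd p q => PAdd (psubst s p) (psubst s q)
  | PMul p q => PMul (psubst s p) (psubst s q)
  | POpp p => POpp (psubst s p)
  | _ => p
  end.

(** A sufficient syntactic test: [None] only says that no degree was read off, and is also returned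
    for zero. *)
Fixpoint pdeg (p : pexp) : option nat :=
  match p with
  | PVar _ => Some 1%N
  | PZero => None
  | POne => Some 0%N
  | PAdd p q => match pdeg p, pdeg q with
      Some d, Some e => if d == e then Some d else None | _, _ => None end
  | PMul p q => match pdeg p, pdeg q with
      Some d, Some e => Some (d + e)%N | _, _ => None end
  | POpp p => pdeg p
  end.

(** * Soundness of the formal computations *)

Section Evaluation.
Variables (n : nat) (vars : seq {mpoly rat[n]}).
Local Notation R := {mpoly rat[n]}.

Fixpoint ev (p : pexp) : R :=
  match p with
  | PVar i => vars`_i
  | PZero => 0
  | POne => 1
  | PAdd p q => ev p + ev q
  | PMul p q => ev p * ev q
  | POpp p => - ev p
  end.

(** Variable i is encoded by the positive i + 1. Lookup recurses on binary digits; written as the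
    head of a jump, it becomes accessible to induction on i. *)
Lemma BinList_nth (x0 : R) i s : BinList.nth x0 (BinPos.Pos.of_succ_nat i) s = nth x0 s i.
Proof.
elim: i s => [|i IHi] s; first by case: s.
have tlE (r : seq R) j : BinList.nth x0 j r = List.hd x0 (BinList.jump j (x0 :: r)).
  exact: (BinList.nth_jump x0 j (x0 :: r)).
rewrite /= tlE BinList.jump_succ /= BinList.jump_tl /= -BinList.nth_jump IHi.
by case: s => //=; rewrite nth_nil.
Qed.

Lemma peqbP p q : peqb p q -> ev p = ev q.
Proof.
have Rth : @Ring_theory.ring_theory R 0 1 +%R *%R (fun p q => p - q) -%R eq.
  split=> //; [exact: add0r|exact: addrC|exact: addrA|exact: mul1r|exact: mulrC
    |exact: mulrA|exact: mulrDl|exact: subrr].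
have Rext : Ring_theory.ring_eq_ext (+%R : R -> R -> R) *%R -%R eq.
  by split=> [? ? -> ? ? ->|? ? -> ? ? ->|? ? ->].
have Req := RelationClasses.eq_equivalence (A := R).
pose phi := InitialRing.gen_phiZ (0 : R) 1 +%R *%R -%R.
have evE r : ev r = Ring_polynom.PEeval 0 1 +%R *%R (fun p q => p - q) -%R phi
    Ring_theory.id_phi_N (Ring_theory.pow_N 1 *%R) vars (to_pexpr r).
  by elim: r => //= [i|r -> s ->|r -> s ->|r ->] //; rewrite BinList_nth.
rewrite !evE => pq.
have RZ := InitialRing.gen_phiZ_morph Req Rext Rth.
exact: (Ring_polynom.ring_correct Req Rext (Ring_theory.Rth_ARth Req Rext Rth) RZ
  (Ring_theory.pow_N_th 1 *%R Req) (InitialRing.Ztriv_div_th Req phi) 0 vars nil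
  (to_pexpr p) (to_pexpr q) I pq).
Qed.

Lemma ev_psubst (s : nat -> pexp) (theta : {rmorphism R -> R}) p :
  (forall i, ev (s i) = theta (vars`_i)) ->
  ev (psubst s p) = theta (ev p).
Proof.
move=> h; elim: p => //= [||p -> q ->|p -> q ->|p ->].
- by rewrite rmorph0.
- by rewrite rmorph1.
- by rewrite rmorphD.
- by rewrite rmorphM.
- by rewrite rmorphN.
Qed.

Hypothesis vars_hom : forall i, vars`_i \is 1.-homog.

Lemma pdegP p d : pdeg p = Some d -> ev p \is d.-homog.
Proof.
elim: p d => //= [i d [<-]|d [<-]|p IHp q IHq d|p IHp q IHq d|p IHp d /IHp].
- exact: vars_hom.
- exact: dhomog1.
- case: (pdeg p) IHp => // a /(_ _ erefl) hp; case: (pdeg q) IHq => // b /(_ _ erefl) hq.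
  by case: eqP => // ab [<-]; apply: rpredD; rewrite // ab.
- case: (pdeg p) IHp => // a /(_ _ erefl) hp; case: (pdeg q) IHq => // b /(_ _ erefl) hq.
  by case=> <-; apply: dhomogM.
- by rewrite rpredN.
Qed.

Section Rows.
Implicit Types I J : eqType.

(** A column may be listed several times, its entries adding up, so that concatenating rows adds
    them. *)
Definition row_sem J (s : seq (J * pexp)) (l : J) : R := \sum_(x <- s | x.1 == l) ev x.2.

Definition row_scale (J : Type) (p : pexp) (s : seq (J * pexp)) := [seq (x.1, PMul p x.2) | x <- s].

Definition row_subst (J : Type) f (s : seq (J * pexp)) := [seq (x.1, psubst f x.2) | x <- s].

Definition row_comp (I J : Type) (s : seq (I * pexp)) (M : I -> seq (J * pexp)) :=
  flatten [seq row_scale x.2 (M x.1) | x <- s].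

Definition row_coef J (s : seq (J * pexp)) (l : J) :=
  foldr (fun x p => if x.1 == l then PAdd x.2 p else p) PZero s.

Definition row_eqb J (s s' : seq (J * pexp)) :=
  all (fun l => peqb (row_coef s l) (row_coef s' l)) (unzip1 (s ++ s')).

Lemma row_sem_nil J (l : J) : row_sem [::] l = 0.
Proof. exact: big_nil. Qed.

Lemma row_sem_cons J (x : J * pexp) s l :
  row_sem (x :: s) l = (if x.1 == l then ev x.2 else 0) + row_sem s l.
Proof. by rewrite /row_sem big_cons; case: ifP => // _; rewrite add0r. Qed.

Lemma row_sem_cat J (s s' : seq (J * pexp)) l : row_sem (s ++ s') l = row_sem s l + row_sem s' l.
Proof. exact: big_cat. Qed.

Lemma row_sem_scale J p (s : seq (J * pexp)) l : row_sem (row_scale p s) l = ev p * row_sem s l.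
Proof. by rewrite /row_sem big_map mulr_sumr. Qed.

Lemma row_sem_opp J (s : seq (J * pexp)) l : row_sem (row_scale (POpp POne) s) l = - row_sem s l.
Proof. by rewrite row_sem_scale mulN1r. Qed.

Lemma row_sem_subst J f (theta : {rmorphism R -> R}) (s : seq (J * pexp)) l :
  (forall i, ev (f i) = theta (vars`_i)) ->
  row_sem (row_subst f s) l = theta (row_sem s l).
Proof.
move=> h; rewrite /row_sem big_map rmorph_sum; apply: eq_bigr => x _ /=.
exact: ev_psubst.
Qed.

Lemma row_sem_comp (I : finType) J (s : seq (I * pexp)) (M : I -> seq (J * pexp)) l :
  row_sem (row_comp s M) l = \sum_i row_sem s i * row_sem (M i) l.
Proof.
elim: s => [|x s IHs].
  by rewrite row_sem_nil big1 // => i _; rewrite row_sem_nil mul0r.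
rewrite /row_comp /= row_sem_cat -/(row_comp s M) IHs row_sem_scale.
under [RHS]eq_bigr => i _ do rewrite row_sem_cons mulrDl.
rewrite big_split /=; congr (_ + _).
rewrite (bigD1 x.1) //= eqxx big1 ?addr0 // => i /negPf.
by rewrite eq_sym => ->; rewrite mul0r.
Qed.

Lemma ev_row_coef J (s : seq (J * pexp)) l : ev (row_coef s l) = row_sem s l.
Proof.
elim: s => [|x s IHs]; first by rewrite row_sem_nil.
by rewrite row_sem_cons /=; case: ifP => _ /=; rewrite IHs ?add0r.
Qed.

Lemma row_sem_notin J (s : seq (J * pexp)) l : l \notin unzip1 s -> row_sem s l = 0.
Proof.
elim: s => [|x s IHs]; first by rewrite row_sem_nil.
by rewrite row_sem_cons inE negb_or eq_sym => /andP[/negPf -> /IHs ->]; rewrite addr0.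
Qed.

Lemma row_eqbP J (s s' : seq (J * pexp)) : row_eqb s s' -> row_sem s =1 row_sem s'.
Proof.
move=> /allP h l; have [ls|] := boolP (l \in unzip1 (s ++ s')).
  by rewrite -!ev_row_coef; apply/peqbP/h.
rewrite /unzip1 map_cat mem_cat negb_or => /andP[? ?].
by rewrite !row_sem_notin.
Qed.

End Rows.

Definition row_shift_ok (C D : bicx n) (dj dk q : int) (i : gen C) (s : seq (gen D * pexp)) :=
  all (fun x => [&& hdeg D x.1 == hdeg C i + dj, tdeg D x.1 == tdeg C i + dk &
    if pdeg x.2 is Some d then (2 * d)%:Z + qsh D x.1 == qsh C i + q else false]) s.

(** Entries listed for the same column are tested one by one; their common quantum degree forces
    equal polynomial degrees, so the sum is homogeneous. *)
Lemma row_shift_okP (C D : bicx n) dj dk q (i : gen C) (s : seq (gen D * pexp)) l :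
  row_shift_ok dj dk q i s -> row_sem s l != 0 ->
  [/\ hdeg D l = hdeg C i + dj, tdeg D l = tdeg C i + dk &
     exists d, (2 * d)%:Z + qsh D l = qsh C i + q /\ row_sem s l \is d.-homog].
Proof.
elim: s => [|x s IHs]; first by rewrite row_sem_nil eqxx.
rewrite row_sem_cons => /= /andP[/and3P[/eqP ehx /eqP etx]].
case Ex: (pdeg x.2) => [d|] // /eqP edx /IHs {}IHs; move/pdegP: Ex => hx.
have [xl _|_] := eqVneq x.1 l; last by rewrite add0r.
rewrite -{}xl in IHs *; split=> //; exists d; split=> //; apply: rpredD => //.
have [->|/IHs [_ _ [e [ee he]]]] := eqVneq (row_sem s x.1) 0; first exact: rpred0.
by move: ee; rewrite -edx => /addIr [] /eqP; rewrite eqn_pmul2l // => /eqP <-.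
Qed.

End Evaluation.

(** * Rows of tensor products and of crossing complexes *)

Section RowSums.
Variables (n : nat) (vars : seq {mpoly rat[n]}).
Local Notation row_sem := (row_sem vars).
Local Notation ev := (ev vars).

Definition row_map (I J : Type) (f : I -> J) (s : seq (I * pexp)) := [seq (f x.1, x.2) | x <- s].

Lemma row_sem_map (I J : eqType) (f : I -> J) s l :
  injective f -> row_sem (row_map f s) (f l) = row_sem s l.
Proof.
move=> f_inj; elim: s => [|x s IHs]; first by rewrite !row_sem_nil.
by rewrite /= !row_sem_cons -IHs /= (inj_eq f_inj).
Qed.

Lemma row_sem_map_out (I J : eqType) (f : I -> J) s l :
  (forall i, f i != l) -> row_sem (row_map f s) l = 0.
Proof.
move=> h; elim: s => [|x s IHs]; first by rewrite row_sem_nil.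
by rewrite /= row_sem_cons IHs /= (negPf (h _)) addr0.
Qed.

(** [sg] marks the left generators of odd degree, where the Koszul sign enters. *)
Definition row_tens (I J : Type) (sg : I -> bool) (M : I -> seq (I * pexp))
    (N : J -> seq (J * pexp)) (g : I * J) :=
  row_map (fun i => (i, g.2)) (M g.1) ++
  row_map (fun j => (g.1, j)) (if sg g.1 then row_scale (POpp POne) (N g.2) else N g.2).

Lemma row_sem_tens (I J : eqType) sg (M : I -> seq (I * pexp)) (N : J -> seq (J * pexp))
    (g l : I * J) :
  row_sem (row_tens sg M N g) l =
    (if g.2 == l.2 then row_sem (M g.1) l.1 else 0)
  + (if g.1 == l.1 then (if sg g.1 then -1 else 1) * row_sem (N g.2) l.2 else 0).
Proof.
rewrite row_sem_cat; case: g l => [g1 g2] [l1 l2] /=; congr (_ + _); case: eqP => [<-|ne].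
- by apply: (@row_sem_map _ _ (fun i => (i, g2))) => x y [].
- by apply: row_sem_map_out => i; rewrite xpair_eqE; move/eqP/negPf: ne => ->; rewrite andbF.
- rewrite (@row_sem_map _ _ (fun j => (g1, j))) => [|x y []//].
  by case: sg; rewrite ?row_sem_opp ?mulN1r ?mul1r.
- by apply: row_sem_map_out => i; rewrite xpair_eqE; move/eqP/negPf: ne => ->.
Qed.

Definition row_plus (I : Type) (M N : I -> seq (I * pexp)) (g : I + I) :=
  match g with inl i => row_map inl (M i) | inr i => row_map inr (N i) end.

Definition row_cross (I : Type) (M : I -> seq (I * pexp)) (g : I + I) : seq ((I + I) * pexp) :=
  match g with inl i => row_map inr (M i) | inr _ => [::] end.

Lemma row_sem_plus (I : eqType) (M N : I -> seq (I * pexp)) (g l : I + I) :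
  row_sem (row_plus M N g) l = match g, l with
    | inl i, inl j => row_sem (M i) j | inr i, inr j => row_sem (N i) j | _, _ => 0 end.
Proof.
by case: g l => [i|i] [j|j] /=; rewrite ?row_sem_map ?row_sem_map_out // => x y [].
Qed.

Lemma row_sem_cross (I : eqType) (M : I -> seq (I * pexp)) (g l : I + I) :
  row_sem (row_cross M g) l = match g, l with inl i, inr j => row_sem (M i) j | _, _ => 0 end.
Proof.
by case: g l => [i|i] [j|j] /=; rewrite ?row_sem_map ?row_sem_map_out ?row_sem_nil // => x y [].
Qed.

Local Notation i0 := (@Ordinal 4 0 isT).
Local Notation i1 := (@Ordinal 4 1 isT).
Local Notation i2 := (@Ordinal 4 2 isT).
Local Notation i3 := (@Ordinal 4 3 isT).

Section Crossing.
Variables x1 x2 y1 y2 : pexp.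

Definition vd_row (i : 'I_4) : seq ('I_4 * pexp) :=
  match val i with
  | 0%N => [:: (i1, (y1 - x1) * (y1 - x2)); (i2, y1 + y2 - x1 - x2)]
  | 1%N => [:: (i3, x1 + x2 - y1 - y2)]
  | 2%N => [:: (i3, (y1 - x1) * (y1 - x2))]
  | _ => [::] end%P.

Definition sd_row (i : 'I_4) : seq ('I_4 * pexp) :=
  match val i with
  | 0%N => [:: (i1, y1 - x1); (i2, y2 - x2)]
  | 1%N => [:: (i3, x2 - y2)]
  | 2%N => [:: (i3, y1 - x1)]
  | _ => [::] end%P.

Definition chi_in_row (i : 'I_4) : seq ('I_4 * pexp) :=
  match val i with
  | 0%N => [:: (i0, 1)]
  | 1%N => [:: (i1, y1 - x2); (i2, 1)]
  | 2%N => [:: (i2, 1)]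
  | _ => [:: (i3, y1 - x2)] end%P.

Definition chi_out_row (i : 'I_4) : seq ('I_4 * pexp) :=
  match val i with
  | 0%N => [:: (i0, y1 - x2)]
  | 1%N => [:: (i1, 1); (i2, POpp 1)]
  | 2%N => [:: (i2, y1 - x2)]
  | _ => [:: (i3, 1)] end%P.

Lemma vdE i l : vd (ev x1) (ev x2) (ev y1) (ev y2) i l = row_sem (vd_row i) l.
Proof.
case: i => [[|[|[|[|i]]]] //= hi]; case: l => [[|[|[|[|l]]]] //= hl];
  rewrite /vd /vd_row /=; by rewrite ?row_sem_cons ?row_sem_nil -?val_eqE /= ?addr0 ?add0r.
Qed.

Lemma sdE i l : sd (ev x1) (ev x2) (ev y1) (ev y2) i l = row_sem (sd_row i) l.
Proof.
case: i => [[|[|[|[|i]]]] //= hi]; case: l => [[|[|[|[|l]]]] //= hl];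
  rewrite /sd /sd_row /=; by rewrite ?row_sem_cons ?row_sem_nil -?val_eqE /= ?addr0 ?add0r.
Qed.

Lemma chi_inE i l : chi_in (ev x2) (ev y1) i l = row_sem (chi_in_row i) l.
Proof.
case: i => [[|[|[|[|i]]]] //= hi]; case: l => [[|[|[|[|l]]]] //= hl];
  rewrite /chi_in /chi_in_row /=; by rewrite ?row_sem_cons ?row_sem_nil -?val_eqE /= ?addr0 ?add0r.
Qed.

Lemma chi_outE i l : chi_out (ev x2) (ev y1) i l = row_sem (chi_out_row i) l.
Proof.
case: i => [[|[|[|[|i]]]] //= hi]; case: l => [[|[|[|[|l]]]] //= hl];
  rewrite /chi_out /chi_out_row /=; by rewrite ?row_sem_cons ?row_sem_nil -?val_eqE /= ?addr0 ?add0r.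
Qed.

End Crossing.
End RowSums.

(** * Matrices of the two complexes *)

Definition edge_vars : seq {mpoly rat[4 + 2]} :=
  [:: va0 2; va2 2; vb0 2; vb2 2; va1; vb1].

Local Notation R6 := {mpoly rat[4 + 2]}.
Local Notation G8 := ('I_4 + 'I_4)%type.
Local Notation sem := (row_sem edge_vars).

Definition pa0 := PVar 0.
Definition pa2 := PVar 1.
Definition pb0 := PVar 2.
Definition pb2 := PVar 3.
Definition pa1 := PVar 4.
Definition pb1 := PVar 5.

Definition kh_odd (g : G8) := match g with inl i | inr i => (val i == 1%N) || (val i == 2) end.

Definition Cplus_K := row_plus (sd_row pa1 pb0 pb1 pa2) (vd_row pa1 pb0 pb1 pa2).
Definition Cplus_T := row_cross (chi_in_row pb0 pb1).
Definition Cminus_K := row_plus (vd_row pb1 pa0 pa1 pb2) (sd_row pb1 pa0 pa1 pb2).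
Definition Cminus_T := row_cross (chi_out_row pa0 pa1).

Definition kos_row (p : pexp) (b : bool) := if b then [:: (false, p)] else [::].

Definition virt_K : bool * bool -> seq ((bool * bool) * pexp) :=
  row_tens id (kos_row (pb1 - pb0)) (kos_row (pa2 - pa1)).

Definition CT_K : G8 * G8 -> _ := row_tens kh_odd Cplus_K Cminus_K.
Definition CT_T : G8 * G8 -> _ :=
  row_tens (fun g => if g is inr _ then true else false) Cplus_T Cminus_T.
Definition CTv_K : (bool * bool) * G8 -> _ := row_tens (fun b => b.1 (+) b.2) virt_K Cminus_K.
(** The virtual crossing has no crossing differential and sits in homological degree 0, hence no
    sign; the outer shift leaves the matrices unchanged. *)
Definition CTv_T : (bool * bool) * G8 -> _ :=
  row_tens (fun=> false) (fun=> [::]) Cminus_T.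

Lemma dK_CplusE g l : dK Cplus g l = sem (Cplus_K g) l.
Proof. by rewrite row_sem_plus; case: g l => [i|i] [l|l] //=; rewrite -?sdE -?vdE. Qed.

Lemma dT_CplusE g l : dT Cplus g l = sem (Cplus_T g) l.
Proof. by rewrite row_sem_cross; case: g l => [i|i] [l|l] //=; rewrite -chi_inE. Qed.

Lemma dK_CminusE g l : dK Cminus g l = sem (Cminus_K g) l.
Proof. by rewrite row_sem_plus; case: g l => [i|i] [l|l] //=; rewrite -?sdE -?vdE. Qed.

Lemma dT_CminusE g l : dT Cminus g l = sem (Cminus_T g) l.
Proof. by rewrite row_sem_cross; case: g l => [i|i] [l|l] //=; rewrite -chi_outE. Qed.

Lemma dK_CTE g l : dK CT g l = sem (CT_K g) l.
Proof.
rewrite row_sem_tens -dK_CplusE -dK_CminusE /= /sgn.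
congr (_ + _); case: ifP => // _; congr (_ * _).
by case: g.1 => [[[|[|[|[|i]]]] //= hi]|[[|[|[|[|i]]]] //= hi]].
Qed.

Lemma dT_CTE g l : dT CT g l = sem (CT_T g) l.
Proof.
rewrite row_sem_tens -dT_CplusE -dT_CminusE /= /sgn.
by congr (_ + _); case: ifP => // _; congr (_ * _); case: g.1.
Qed.

Lemma kos_rowE p k b c : dK (kos1 (ev edge_vars p) k) b c = sem (kos_row p b) c.
Proof. by case: b c => [] [] /=; rewrite ?row_sem_cons ?row_sem_nil /= ?addr0. Qed.

Lemma dK_CTvE g l : dK (bshift CTv 1 (-2)) g l = sem (CTv_K g) l.
Proof.
rewrite row_sem_tens -dK_CminusE row_sem_tens /= /sgn.
rewrite -!(@kos_rowE _ 2) /=.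
congr (_ + _); case: ifP => // _; first by case: g.1.1.
by case: g.1.1; case: g.1.2.
Qed.

Lemma dT_CTvE g l : dT (bshift CTv 1 (-2)) g l = sem (CTv_T g) l.
Proof.
rewrite row_sem_tens -dT_CminusE row_sem_nil /=.
congr (_ + _); case: ifP => // _; rewrite ?addr0.
by rewrite !if_same add0r; case: ifP => // _; rewrite mulr0.
Qed.

Local Notation i0 := (@Ordinal 4 0 isT).
Local Notation i1 := (@Ordinal 4 1 isT).
Local Notation i2 := (@Ordinal 4 2 isT).
Local Notation i3 := (@Ordinal 4 3 isT).
(* L and R: smoothing and vertex at c+, but vertex and smoothing at c-. *)
Local Notation L0 := (inl i0 : G8). Local Notation R0 := (inr i0 : G8).
Local Notation L1 := (inl i1 : G8). Local Notation R1 := (inr i1 : G8).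
Local Notation L2 := (inl i2 : G8). Local Notation R2 := (inr i2 : G8).
Local Notation L3 := (inl i3 : G8). Local Notation R3 := (inr i3 : G8).
Local Notation GT := (G8 * G8)%type.
Local Notation GTv := ((bool * bool) * G8)%type.
Local Notation M1 := (POpp POne).

(* b1 := b0, with a1 fixed. *)
Definition psub_v (i : nat) : pexp := if i == 5 then pb0 else PVar i.
(* b1 := b0, with a1 - b1 fixed. *)
Definition psub_s (i : nat) : pexp :=
  if i == 4 then (pa1 - pb1 + pb0)%P else if i == 5 then pb0 else PVar i.

Definition sub_v : (4 + 2).-tuple R6 := [tuple va0 2; va2 2; vb0 2; vb2 2; va1; vb0 2].
Definition sub_s : (4 + 2).-tuple R6 :=
  [tuple va0 2; va2 2; vb0 2; vb2 2; va1 - vb1 + vb0 2; vb0 2].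

Definition py := (pb1 - pb0)%P.

(* Minus the derivative in b1 of the Koszul differential D of C(c-).  If k is the
   generator of [b1 - b0], then n |-> n + k * (dCminus_row n) intertwines D at
   b1 = b0 with the differential of [b1 - b0] (x) C(c-). *)
Definition dCminus_row (g : G8) : seq (G8 * pexp) :=
  match g with
  | inl i => match val i with
    | 0%N => [:: (L1, pa1 - pa0); (L2, 1)]
    | 1%N => [:: (L3, POpp 1)]
    | 2%N => [:: (L3, pa1 - pa0)]
    | _ => [::] end
  | inr i => match val i with
    | 0%N => [:: (R1, 1)]
    | 2%N => [:: (R3, 1)]
    | _ => [::] end
  end%P.

(* Kills the smoothing of c+ and generators 0 and 2 of its vertex; generator 1
   of the vertex, which is minus that of b1 + a2 - a1 - b0, goes to minus that
   of a2 - a1. *)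
Definition F_row (g : GT) : seq (GTv * pexp) :=
  (* The vertex of c+ has homological degree 1, so [chi_out] at c- carries a sign in C(T) but not in
     C(T_v); [s] absorbs it. *)
  let s := if g.2 is inl _ then POne else M1 in
  match g.1 with
  | inl _ => [::]
  | inr i => match val i with
    | 3 => row_scale s (((false, false), g.2, POne)
             :: row_map (fun l => ((true, false), l)) (dCminus_row g.2))
    | 1%N => row_scale (POpp s) (((false, true), g.2, POne)
             :: row_scale M1 (row_map (fun l => ((true, true), l)) (dCminus_row g.2)))
    | _ => [::] end
  end.

(* The extra terms on the generators L0, L2 of c- make up for the coefficient
   a1 - a0, which changes under psub_s although a1 - b1 does not. *)
Definition G_row (g : GTv) : seq (GT * pexp) :=
  if g.1.1 then [::] else
  if g.1.2 then
    match g.2 with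
    | inl i => match val i with
      | 0%N => [:: ((R1, L0), M1); ((L2, R0), POne); ((L1, R0), M1);
                 ((R0, L1), POne); ((L0, R2), M1); ((L0, R1), POne)]
      | 2 => [:: ((R1, L2), M1); ((L2, R2), POne); ((L1, R2), M1);
                 ((R0, L3), POne); ((L0, R3), POne)]
      | _ => [:: ((R1, g.2), M1)] end
    | inr _ => [:: ((R1, g.2), POne)]
    end
  else
    match g.2 with
    | inl i => match val i with
      | 0%N => [:: ((R3, L0), POne); ((L3, R0), POne); ((R2, L1), POne);
                 ((L2, R2), M1); ((L2, R1), POne)]
      | 2 => [:: ((R3, L2), POne); ((L3, R2), POne); ((R2, L3), POne); ((L2, R3), POne)]
      | _ => [:: ((R3, g.2), POne)] end
    | inr _ => [:: ((R3, g.2), M1)]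
    end.

(* Minus chi_o at c+: it inverts chi_i up to the factor y that is divided out. *)
Definition A_row (g : GT) : seq (GT * pexp) :=
  if g.1 is inr i then row_scale M1 (row_map (fun j => (inl j, g.2)) (chi_out_row pb0 pb1 i))
  else [::].

(** On vertex generators 0 and 2 of c+, [chi_in] has unit diagonal entries: with -1 here, y B - A
    vanishes on them and the homotopy is linear there. The entries on generators 1 and 3 offset the
    change by (a1 - b1) y, under [psub_s], of the coefficient (a1 - b1)(a1 - a0) in the Koszul
    differential of the vertex of c-. *)
Definition B_row (g : GT) : seq (GT * pexp) :=
  match g with
  | (inr i, n) => match val i, n with
    | 0%N, _ => [:: ((L0, n), M1)]
    | 2, _ => [:: ((L2, n), M1)]
    | 3, inl j => match val j with
      | 0%N => [:: ((L2, L1), POne)]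
      | 2 => [:: ((L2, L3), POne)]
      | _ => [::] end
    | 1%N, inl j => match val j with
      | 0%N => [:: ((L0, L1), M1)]
      | 2 => [:: ((L0, L3), M1)]
      | _ => [::] end
    | _, _ => [::] end
  | _ => [::] end.

(** The standard null-homotopy of -y on the Koszul factor [b1 - b0]. *)
Definition Av_row (g : GTv) : seq (GTv * pexp) :=
  if g.1.1 then [::] else [:: ((true, g.1.2, g.2), M1)].

(** Explicit lists turn a check over all generators into an evaluation. *)
Definition enum8 : seq G8 := [:: L0; L1; L2; L3; R0; R1; R2; R3].
Definition enumT : seq GT := [seq (g, h) | g <- enum8, h <- enum8].
Definition enumTv : seq GTv :=
  [seq (b, h) | b <- [seq (c, d) | c <- [:: true; false], d <- [:: true; false]], h <- enum8].

Lemma mem_enum8 g : g \in enum8.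
Proof. by case: g => [[[|[|[|[|i]]]] hi]|[[|[|[|[|i]]]] hi]]. Qed.

Lemma enumTP (P : pred GT) : all P enumT -> forall g, P g.
Proof. by move=> /allP h [g1 g2]; apply: h; apply: allpairs_f; apply: mem_enum8. Qed.

Lemma enumTvP (P : pred GTv) : all P enumTv -> forall g, P g.
Proof.
move=> /allP h [[c d] g]; apply/h/allpairs_f; last exact: mem_enum8.
by case: c d => [] [].
Qed.

(** * The two substitutions b1 := b0 *)

Lemma edge_varsE (i : 'I_(4 + 2)) : 'X_i = edge_vars`_i.
Proof.
by case: i => [[|[|[|[|[|[|i]]]]]] hi] //=; rewrite /va0 /va2 /vb0 /vb2 /va1 /vb1 /evar;
  congr ('X_ _); apply: val_inj.
Qed.

Lemma edge_vars_hom i : edge_vars`_i \is 1.-homog.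
Proof.
(* Past the end of the list the default 0 is homogeneous of every degree. *)
have [hi|hi] := ltnP i 6; last by rewrite nth_default // rpred0.
by rewrite -(edge_varsE (Ordinal hi)) dhomogX; apply/eqP/mdeg1.
Qed.

Lemma comp_edge_vars (t : (4 + 2).-tuple R6) i : edge_vars`_i \mPo t = t`_i.
Proof.
have [hi|hi] := ltnP i 6; last by rewrite !nth_default ?size_tuple // comp_mpoly0.
by rewrite -(edge_varsE (Ordinal hi)) comp_mpolyXU.
Qed.

Lemma psub_vP i : ev edge_vars (psub_v i) = edge_vars`_i \mPo sub_v.
Proof. by rewrite comp_edge_vars; do 6?[case: i => [|i] //]. Qed.

Lemma psub_sP i : ev edge_vars (psub_s i) = edge_vars`_i \mPo sub_s.
Proof. by rewrite comp_edge_vars; do 6?[case: i => [|i] //]. Qed.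

Lemma sub_v_hom i : tnth sub_v i \is 1.-homog.
Proof.
rewrite (tnth_nth 0) -comp_edge_vars -psub_vP; case: i => i hi /=.
by apply: (pdegP edge_vars_hom); case: i hi => [|[|[|[|[|[|i]]]]]].
Qed.

Lemma sub_s_hom i : tnth sub_s i \is 1.-homog.
Proof.
rewrite (tnth_nth 0) -comp_edge_vars -psub_sP; case: i => i hi /=.
by apply: (pdegP edge_vars_hom); case: i hi => [|[|[|[|[|[|i]]]]]].
Qed.

Definition ydiff : R6 := vb1 - vb0 2.

Lemma ydiff_neq0 : ydiff != 0.
Proof.
rewrite /ydiff /vb1 /vb0 /evar subr_eq0; apply/eqP.
move=> /(congr1 (mcoeff U_(rshift 4 (@Ordinal 2 1 isT)))).
rewrite !mcoeffX eqxx; case: eqP => // /mnmP /(_ (rshift 4 (@Ordinal 2 1 isT))).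
by rewrite !mnm1E eqxx.
Qed.

Lemma sub_v_div i : exists c : rat, 'X_i - tnth sub_v i = ydiff * c%:MP.
Proof.
exists (if val i == 5 then 1 else 0); rewrite edge_varsE (tnth_nth 0).
by case: i => [[|[|[|[|[|[|i]]]]]] hi] //=; rewrite ?subrr ?mpolyC0 ?mulr0 ?mulr1.
Qed.

Lemma sub_s_div i : exists c : rat, 'X_i - tnth sub_s i = ydiff * c%:MP.
Proof.
exists (if (val i == 4) || (val i == 5) then 1 else 0); rewrite edge_varsE (tnth_nth 0).
case: i => [[|[|[|[|[|[|i]]]]]] hi] //=; rewrite ?subrr ?mpolyC0 ?mulr0 ?mulr1 //.
by rewrite opprD opprB addrA [va1 + _]addrC subrK.
Qed.

Lemma mpoly_rmorph_ext n (f g : {rmorphism {mpoly rat[n]} -> {mpoly rat[n]}}) :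
  (forall c, f c%:MP = g c%:MP) -> (forall i, f 'X_i = g 'X_i) -> f =1 g.
Proof.
move=> hC hX p; rewrite (mpolyE p) !rmorph_sum; apply: eq_bigr => m _.
rewrite -mul_mpolyC !rmorphM hC /= mpolyXE_id !rmorph_prod; congr (_ * _).
by apply: eq_bigr => i _; rewrite !rmorphXn hX.
Qed.

(** Both substitutions are the identity modulo y and send y to 0, so the one applied last absorbs
    the other. Thus g f and f g are semilinear over the substitution used in their respective
    homotopies. *)
Lemma sub_vs p : (p \mPo sub_v) \mPo sub_s = p \mPo sub_s.
Proof.
apply: (@mpoly_rmorph_ext _ (comp_mpoly sub_s \o comp_mpoly sub_v) (comp_mpoly sub_s)) => [c|i] /=.
  by rewrite !comp_mpolyC.
rewrite edge_varsE comp_edge_vars.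
by case: i => [[|[|[|[|[|[|i]]]]]] hi] //=; rewrite (comp_edge_vars _ 2) (comp_edge_vars _ 5).
Qed.

Lemma sub_sv p : (p \mPo sub_s) \mPo sub_v = p \mPo sub_v.
Proof.
apply: (@mpoly_rmorph_ext _ (comp_mpoly sub_v \o comp_mpoly sub_s) (comp_mpoly sub_v)) => [c|i] /=.
  by rewrite !comp_mpolyC.
rewrite edge_varsE comp_edge_vars.
case: i => [[|[|[|[|[|[|i]]]]]] hi] //=.
  rewrite rmorphD rmorphB /= (comp_edge_vars _ 4) (comp_edge_vars _ 5) (comp_edge_vars _ 2).
  by rewrite subrK.
by rewrite (comp_edge_vars _ 2) (comp_edge_vars _ 5).
Qed.

(** * Row criteria for maps and homotopies *)

Section RowOperators.
Variables (n : nat) (vars : seq {mpoly rat[n]}).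
Local Notation R := {mpoly rat[n]}.
Local Notation row_sem := (row_sem vars).

(** The coefficient map reaches the source differential, whose rows are therefore substituted before
    the comparison. *)
Lemma slin_row_comm (C D : bicx n) (theta : {rmorphism R -> R}) f
    (M : gen C -> gen C -> R) (N : gen D -> gen D -> R)
    (rM : gen C -> seq (gen C * pexp)) (rN : gen D -> seq (gen D * pexp))
    (rF : gen C -> seq (gen D * pexp)) :
  (forall i, ev vars (f i) = theta vars`_i) ->
  (forall i l, M i l = row_sem (rM i) l) -> (forall i l, N i l = row_sem (rN i) l) ->
  (forall i, row_eqb (row_comp (row_subst f (rM i)) rF) (row_comp (rF i) rN)) ->
  forall v, slin theta (fun i => row_sem (rF i)) (app M v)
          = app N (slin theta (fun i => row_sem (rF i)) v).
Proof.
move=> hf hM hN h v; rewrite !slin_app !slin_comp; apply: eq_slin => i l.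
have := row_eqbP vars (h i) l; rewrite !row_sem_comp => e.
under eq_bigr => j _ do rewrite hM -(row_sem_subst _ _ hf).
by rewrite e; apply: eq_bigr => j _; rewrite hN.
Qed.

Lemma slin_row_shifts (C D : bicx n) (t : n.-tuple R) (rF : gen C -> seq (gen D * pexp)) :
  (forall i, vars`_i \is 1.-homog) -> (forall i, tnth t i \is 1.-homog) ->
  (forall i, row_shift_ok 0 0 0 i (rF i)) ->
  shifts_by 0 0 (slin (comp_mpoly t) (fun i => row_sem (rF i))).
Proof.
move=> hv ht h; apply: (@slin_shifts _ _ _ _ _ 0) => [|d p hp _|i l].
- exact: comp_mpoly0.
- by exists d; rewrite addn0; split=> //; apply: comp_mpoly_homog.
- by move/(row_shift_okP hv (h i)).
Qed.

Variables (t : n.-tuple R) (y : R) (f : nat -> pexp) (py : pexp).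
Hypotheses (vars_hom : forall i, vars`_i \is 1.-homog) (t_hom : forall i, tnth t i \is 1.-homog).
Hypotheses (y_neq0 : y != 0) (t_div : forall i, exists c : rat, 'X_i - tnth t i = y * c%:MP).
Hypotheses (fE : forall i, ev vars (f i) = vars`_i \mPo t) (pyE : ev vars py = y).
Variables (C : bicx n) (rA rB : gen C -> seq (gen C * pexp)).

Definition row_htpy : elt C -> elt C :=
  div_htpy t_hom t_div (fun i => row_sem (rA i)) (fun i => row_sem (rB i)).

Let rA' i := row_scale py (rB i) ++ row_scale (POpp POne) (rA i).

Let rA'E i l : y * row_sem (rB i) l - row_sem (rA i) l = row_sem (rA' i) l.
Proof. by rewrite row_sem_cat row_sem_opp row_sem_scale pyE. Qed.

Lemma row_htpy_comm (M : gen C -> gen C -> R) rM :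
  (forall i l, M i l = row_sem (rM i) l) ->
  (forall i, row_eqb (row_comp (rA i) rM) (row_comp (rM i) rA)) ->
  (forall i, row_eqb (row_comp (rA' i) rM) (row_comp (row_subst f (rM i)) rA')) ->
  forall v, app M (row_htpy v) = row_htpy (app M v).
Proof.
move=> hM h h'; apply: div_htpy_comm => // i l.
  have := row_eqbP vars (h i) l; rewrite !row_sem_comp => e.
  under eq_bigr => j _ do rewrite hM; rewrite e.
  by apply: eq_bigr => j _; rewrite hM.
have := row_eqbP vars (h' i) l; rewrite !row_sem_comp => e.
under eq_bigr => j _ do rewrite rA'E hM; rewrite e.
apply: eq_bigr => j _.
by rewrite (row_sem_subst (theta := comp_mpoly t) _ _ fE) -hM rA'E.
Qed.

Lemma row_htpy_anticomm (D : bicx n) (M : gen C -> gen C -> R) rM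
    (rF : gen C -> seq (gen D * pexp)) (rG : gen D -> seq (gen C * pexp)) (s : n.-tuple R) :
  (forall i l, M i l = row_sem (rM i) l) ->
  (forall p, (p \mPo s) \mPo t = p \mPo t) ->
  (forall i, row_eqb (row_comp (rA i) rM ++ row_comp (rM i) rA) [:: (i, POpp py)]) ->
  (forall i, row_eqb (row_comp (rA' i) rM ++ row_comp (row_subst f (rM i)) rA')
     (row_scale py (row_comp (row_subst f (rF i)) rG))) ->
  forall v, slin (comp_mpoly t) (fun i => row_sem (rG i))
      (slin (comp_mpoly s) (fun i => row_sem (rF i)) v) - v
    = app M (row_htpy v) + row_htpy (app M v).
Proof.
move=> hM st h h' v; rewrite slin_comp.
(* The matrix of the composite; by [st] its coefficient map is the single substitution t, as
   [div_htpy_anticomm] requires. *)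
pose Phi i l := \sum_j (row_sem (rF i) j \mPo t) * row_sem (rG j) l.
set u := slin _ _ _; have {u} -> : u = slin (comp_mpoly t) Phi v.
  by apply/ffunP=> l; rewrite !ffunE; apply: eq_bigr => i _; congr (_ * _); apply: st.
symmetry; apply: div_htpy_anticomm => // i l.
  have := row_eqbP vars (h i) l.
  rewrite row_sem_cat !row_sem_comp row_sem_cons row_sem_nil addr0 /= pyE => <-.
  by congr (_ + _); apply: eq_bigr => j _; rewrite hM.
have := row_eqbP vars (h' i) l.
rewrite row_sem_cat row_sem_scale !row_sem_comp pyE => e.
under eq_bigr => j _ do rewrite rA'E hM.
under [X in _ + X]eq_bigr => j _ do
  rewrite rA'E hM -(row_sem_subst (theta := comp_mpoly t) _ _ fE).
rewrite e; congr (_ * _); apply: eq_bigr => j _.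
by rewrite (row_sem_subst (theta := comp_mpoly t) _ _ fE).
Qed.

Lemma row_htpy_shifts dj dk :
  (forall i, row_shift_ok dj dk 2 i (rA i)) -> (forall i, row_shift_ok dj dk 0 i (rB i)) ->
  shifts_by dj dk row_htpy.
Proof.
move=> hA hB; apply: div_htpy_shifts => // i l.
  exact: row_shift_okP.
by move/(row_shift_okP vars_hom (hB i)) => [-> -> [d [ed hd]]];
  split=> //; exists d; rewrite ed addr0.
Qed.

End RowOperators.

Lemma slin_comp_elinear m (C D : bicx (4 + m)) (t : (4 + m).-tuple {mpoly rat[4 + m]}) M :
  (forall i, evar m i \mPo t = evar m i) -> elinear (@slin _ C D (comp_mpoly t) M).
Proof.
move=> hX; apply: slin_elinear => [p q|c p|i p]; first exact: comp_mpolyD.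
  by rewrite rmorphM /= comp_mpolyC.
by rewrite rmorphM /= hX.
Qed.

Lemma row_htpy_elinear m vars (t : (4 + m).-tuple {mpoly rat[4 + m]}) y
    (t_hom : forall i, tnth t i \is 1.-homog)
    (t_div : forall i, exists c : rat, 'X_i - tnth t i = y * c%:MP) C rA rB :
  y != 0 -> (forall i, evar m i \mPo t = evar m i) ->
  elinear (@row_htpy _ vars t y t_hom t_div C rA rB).
Proof.
move=> y0 hX; apply: elinear_add; last exact: slin_comp_elinear.
apply: slin_elinear => [p q|c p|i p]; first exact: subst_divD.
  by apply: subst_divMl => //; rewrite comp_mpolyC.
by apply: subst_divMl.
Qed.

(** * The equivalence *)

Local Notation Tv := (bshift CTv 1 (-2)).

Definition fmap : elt CT -> elt Tv :=
  slin (C := CT) (D := Tv) (comp_mpoly sub_v) (fun i => sem (F_row i)).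

Definition gmap : elt Tv -> elt CT :=
  slin (C := Tv) (D := CT) (comp_mpoly sub_s) (fun i => sem (G_row i)).

Lemma sub_v_evar i : evar 2 i \mPo sub_v = evar 2 i.
Proof.
rewrite /evar edge_varsE comp_edge_vars.
by case: i => [[|[|[|[|i]]]] hi].
Qed.

Lemma sub_s_evar i : evar 2 i \mPo sub_s = evar 2 i.
Proof.
rewrite /evar edge_varsE comp_edge_vars.
by case: i => [[|[|[|[|i]]]] hi].
Qed.

Lemma fmap_bimap : bimap fmap.
Proof.
split.
- exact/slin_comp_elinear/sub_v_evar.
- apply: (slin_row_shifts edge_vars_hom sub_v_hom) => i.
  by move: i; apply: enumTP.
- apply: (@slin_row_comm _ edge_vars CT Tv _ psub_v _ _ CT_K CTv_K F_row).
  + exact: psub_vP.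
  + exact: dK_CTE.
  + exact: dK_CTvE.
  + by apply: enumTP; vm_compute.
- apply: (@slin_row_comm _ edge_vars CT Tv _ psub_v _ _ CT_T CTv_T F_row).
  + exact: psub_vP.
  + exact: dT_CTE.
  + exact: dT_CTvE.
  + by apply: enumTP; vm_compute.
Qed.

Lemma gmap_bimap : bimap gmap.
Proof.
split.
- exact/slin_comp_elinear/sub_s_evar.
- apply: (slin_row_shifts edge_vars_hom sub_s_hom) => i.
  by move: i; apply: enumTvP.
- apply: (@slin_row_comm _ edge_vars Tv CT _ psub_s _ _ CTv_K CT_K G_row).
  + exact: psub_sP.
  + exact: dK_CTvE.
  + exact: dK_CTE.
  + by apply: enumTvP; vm_compute.
- apply: (@slin_row_comm _ edge_vars Tv CT _ psub_s _ _ CTv_T CT_T G_row).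
  + exact: psub_sP.
  + exact: dT_CTvE.
  + exact: dT_CTE.
  + by apply: enumTvP; vm_compute.
Qed.

Lemma zero_elinear m (C D : bicx (4 + m)) : elinear (fun _ : elt C => 0 : elt D).
Proof.
by split=> *; apply/ffunP=> l; rewrite !ffunE ?addr0 ?mulr0.
Qed.

Lemma zero_shifts n (C D : bicx n) dj dk : shifts_by dj dk (fun _ : elt C => 0 : elt D).
Proof. by move=> d j k v _ i; rewrite ffunE eqxx. Qed.

Lemma app0 n (C : bicx n) (M : gen C -> gen C -> {mpoly rat[n]}) : app M 0 = 0 :> elt C.
Proof.
by apply/ffunP=> l; rewrite !ffunE big1 // => i _; rewrite ffunE mul0r.
Qed.

Lemma gf_htpy : htpy (gmap \o fmap) id.
Proof.
pose h : elt CT -> elt CT := row_htpy edge_vars sub_s_hom sub_s_div (C := CT) A_row B_row.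
exists (fun=> 0), h; split.
- by split; [exact: zero_elinear | exact/row_htpy_elinear/sub_s_evar/ydiff_neq0].
- split; first exact: zero_shifts.
  apply: (@row_htpy_shifts _ edge_vars sub_s ydiff edge_vars_hom sub_s_hom ydiff_neq0
    sub_s_div CT A_row B_row) => i;
    by move: i; apply: enumTP.
- move=> v; rewrite app0 !add0r.
  apply: (@row_htpy_anticomm _ edge_vars sub_s ydiff psub_s py sub_s_hom ydiff_neq0
    sub_s_div psub_sP erefl CT A_row B_row Tv _ CT_T F_row G_row sub_v).
  + exact: dT_CTE.
  + exact: sub_vs.
  + by apply: enumTP; vm_compute.
  + by apply: enumTP; vm_compute.
- apply: (@row_htpy_comm _ edge_vars sub_s ydiff psub_s py sub_s_hom ydiff_neq0
    sub_s_div psub_sP erefl CT A_row B_row _ CT_K).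
  + exact: dK_CTE.
  + by apply: enumTP; vm_compute.
  + by apply: enumTP; vm_compute.
- by move=> v; rewrite app0.
Qed.

Lemma fg_htpy : htpy (fmap \o gmap) id.
Proof.
pose h : elt Tv -> elt Tv :=
  row_htpy edge_vars sub_v_hom sub_v_div (C := Tv) Av_row (fun=> [::]).
exists h, (fun=> 0); split.
- by split; [exact/row_htpy_elinear/sub_v_evar/ydiff_neq0 | exact: zero_elinear].
- split; last exact: zero_shifts.
  apply: (@row_htpy_shifts _ edge_vars sub_v ydiff edge_vars_hom sub_v_hom ydiff_neq0
    sub_v_div Tv Av_row (fun=> [::])) => i //.
  by move: i; apply: enumTvP.
- move=> v; rewrite app0 !addr0.
  apply: (@row_htpy_anticomm _ edge_vars sub_v ydiff psub_v py sub_v_hom ydiff_neq0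
    sub_v_div psub_vP erefl Tv Av_row (fun=> [::]) CT _ CTv_K G_row F_row sub_s).
  + exact: dK_CTvE.
  + exact: sub_sv.
  + by apply: enumTvP; vm_compute.
  + by apply: enumTvP; vm_compute.
- by move=> v; rewrite app0.
- apply: (@row_htpy_comm _ edge_vars sub_v ydiff psub_v py sub_v_hom ydiff_neq0
    sub_v_div psub_vP erefl Tv Av_row (fun=> [::]) _ CTv_T).
  + exact: dT_CTvE.
  + by apply: enumTvP; vm_compute.
  + by apply: enumTvP; vm_compute.
Qed.

Lemma heq_CT_CTv : heq CT Tv.
Proof.
exists fmap, gmap; split;
  [exact: fmap_bimap | exact: gmap_bimap | exact: gf_htpy | exact: fg_htpy].
Qed.

(** * The inequivalence *)

Definition delta_elt n (C : bicx n) (i : gen C) (p : {mpoly rat[n]}) : elt C :=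
  [ffun l => if l == i then p else 0].

Lemma app_delta n (C : bicx n) (M : gen C -> gen C -> {mpoly rat[n]}) i p l :
  app M (delta_elt i p) l = p * M i l.
Proof.
rewrite ffunE (bigD1 i) //= ffunE eqxx big1 ?addr0 // => j /negPf ji.
by rewrite ffunE ji mul0r.
Qed.

Lemma elinear0 m1 m2 (C : bicx (4 + m1)) (D : bicx (4 + m2)) (f : elt C -> elt D) :
  elinear f -> f 0 = 0.
Proof. by case=> fD _ _; apply: (addrI (f 0)); rewrite -fD !addr0. Qed.

Definition sub_0 : (4 + 2).-tuple R6 := [tuple of nseq (4 + 2) 0].

(* The two coefficients are added because chi_o sends generator 1 to 1 - 2. *)
Definition row_top (u : elt CT) : R6 := (u (R3, R1) + u (R3, R2)) \mPo sub_0.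

(** With the variables at 0, the only entries of d_T into these two generators come from [(R3, L1)]
    and cancel; the others are, up to sign, a1 - a0 or b1 - b0. *)
Lemma row_top_dT u : row_top (app (dT CT) u) = 0.
Proof.
have -> : row_top (app (dT CT) u)
    = \sum_i (u i \mPo sub_0) * ((dT CT i (R3, R1) + dT CT i (R3, R2)) \mPo sub_0).
  rewrite /row_top !ffunE -big_split rmorph_sum; apply: eq_bigr => i _.
  by rewrite -rmorphM (mulrDr (u i) (dT CT i _)).
rewrite big1 // => i _; rewrite !dT_CTE -!ev_row_coef.
have top0 j : peqb (psubst (fun=> PZero)
    (PAdd (row_coef (CT_T j) (R3, R1)) (row_coef (CT_T j) (R3, R2)))) PZero.
  by move: j; apply: enumTP; vm_compute.
have := peqbP edge_vars (top0 i); rewrite (ev_psubst (theta := comp_mpoly sub_0)) => [/= ->|j].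
  by rewrite mulr0.
by rewrite /= comp_edge_vars nth_nseq if_same.
Qed.

Lemma not_heq_CT_CT0 : ~ heq CT CT0.
Proof.
case=> f [g [[_ sf _ _] [eg _ _ _] [hK [hT [[eK eT] [sK sT] H _ cK]]] _]].
pose z : elt CT := delta_elt (C := CT) (R3, R2) 1.
have zh : homog_at 0 1 1 z.
  move=> i; rewrite ffunE; have [-> _|_] := eqVneq i (R3, R2); last by rewrite eqxx.
  by split=> //; exists 0%N; split=> //; apply: dhomog1.
have fz0 : f z = 0.
  apply/ffunP=> i; rewrite [RHS]ffunE; apply/eqP/negPn/negP.
  by move/(sf _ _ _ _ zh) => [].
have hKz0 : hK z = 0.
  apply/ffunP=> i; rewrite [RHS]ffunE; apply/eqP/negPn/negP.
  move/(sK _ _ _ _ zh) => [hi ti [m [qi _]]].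
  (* In Hochschild degree 2 and homological degree 1 every generator has positive quantum shift,
     whereas [hK z] has quantum degree 0. *)
  have : (hdeg CT i == 1 + 1) && (tdeg CT i == 1 + 0) ==> (0 < qsh CT i).
    by move: (i); apply: enumTP.
  rewrite hi ti !eqxx /= => q_gt0.
  have : 0 < (2 * m)%:Z + qsh CT i by apply: Num.Theory.ltr_wpDl.
  by rewrite qi.
have dTz0 : app (dT CT) z = 0.
  by apply/ffunP=> l; rewrite app_delta dT_CTE ffunE /CT_T /= row_sem_nil mulr0.
(* Since d_K z is the d_T-boundary of [w], hK (d_K z) = d_T (hK w) is a boundary too. The sign of
   the coefficient undoes the Koszul sign of d_T at [R3]. *)
pose w : elt CT := delta_elt (C := CT) (R3, L3) (vb1 - va1).
have dKz : app (dK CT) z = app (dT CT) w.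
  apply/ffunP=> l; rewrite !app_delta mul1r dK_CTE dT_CTE.
  rewrite -[vb1 - va1]/(ev edge_vars (pb1 - pa1)%P) -row_sem_scale.
  by apply: row_eqbP; vm_compute.
have : g (f z) - z = app (dK CT) (hK z) + hK (app (dK CT) z)
    + app (dT CT) (hT z) + hT (app (dT CT) z) := H z.
rewrite fz0 (elinear0 eg) hKz0 dTz0 (elinear0 eT) dKz -cK app0.
(* What remains is -z = d_T (hK w + hT z), on which [row_top] takes the values -1 and 0. *)
rewrite !add0r addr0 -appD => /(congr1 row_top); rewrite row_top_dT /row_top !ffunE.
rewrite (_ : (R3, R1) == (R3, R2) = false) // eqxx oppr0 add0r rmorphN rmorph1.
by move/eqP; rewrite oppr_eq0 oner_eq0.
Qed.

Theorem theorem4p4 :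
  ~ heq CT CT0 /\ heq CT (bshift CTv 1 (-2)).
Proof. by split; [exact: not_heq_CT_CT0 | exact: heq_CT_CTv]. Qed.
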